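(* Let $\mathbb{K}=\mathbb{R}$ or $\mathbb{K}=\mathbb{C}$, let $m\geq 2$ be a positive integer, and let $p$ be a real number with $m+1<p\leq 2m$. Then $$D_{m+1,p}^{\mathbb{K}}\leq D_{m,p}^{\mathbb{K}}.$$
   Context: For a positive integer $n$ and $1\le p<\infty$, $\ell_p^n$ denotes $\mathbb{K}^n$ with the norm $\|x\|_p=\left(\sum_{i=1}^n|x_i|^p\right)^{1/p}$, and $e_1,\dots,e_n$ are its canonical unit vectors. For an $m$-linear form $T:\ell_p^n\times\cdots\times\ell_p^n\to\mathbb{K}$, its norm is $\|T\|=\sup\{|T(x^{(1)},\dots,x^{(m)})| : \|x^{(k)}\|_p\le 1,\ k=1,\dots,m\}$. For an integer $m\ge 2$ and real $p$ with $m<p\le 2m$, $D_{m,p}^{\mathbb{K}}$ denotes the optimal (i.e. smallest) constant $D\geq 1$ such that $$\left(\sum_{j_1,\dots,j_m=1}^{n}|T(e_{j_1},\dots,e_{j_m})|^{\frac{p}{p-m}}\right)^{\frac{p-m}{p}}\leq D\,\|T\|$$ for all positive integers $n$ and all $m$-linear forms $T:\ell_p^n\times\cdots\times\ell_p^n\to\mathbb{K}$. (By the Hardy--Littlewood inequality for $m$-linear forms, such a finite constant exists.) The constant $D_{m+1,p}^{\mathbb{K}}$ is the one given by this definition with $m+1$ in place of $m$ (so it concerns $(m+1)$-linear forms and the exponent $\frac{p}{p-(m+1)}$). *)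

(* Defs.v *)
From mathcomp Require Import all_boot all_order all_algebra.
From mathcomp Require Import complex.
From mathcomp Require Import all_classical all_reals all_analysis.

Set Implicit Arguments.
Unset Strict Implicit.
Unset Printing Implicit Defensive.

Import Order.TTheory GRing.Theory Num.Theory.

Local Open Scope classical_set_scope.
Local Open Scope ring_scope.

(* The definitions are uniform in a scalar field K with a real-valued modulus
   [abs : K -> R].  The two intended instances are K = R with the absolute
   value and K = R[i] with [cmod]; the modulus is a parameter because the
   library's norm on R[i] takes its values in R[i]. *)

Definition cmod (R : realType) (z : R[i]) : R := complex.Re `|z|.

Section HardyLittlewood.
Context (R : realType) (K : fieldType) (abs : K -> R).

Definition lp_norm (p : R) (n : nat) (x : 'rV[K]_n) : R :=
  (\sum_(i < n) abs (x 0 i) `^ p) `^ p^-1.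

Definition multilinear_form (m n : nat) (T : ('I_m -> 'rV[K]_n) -> K) : Prop :=
  forall (x : 'I_m -> 'rV[K]_n) (k : 'I_m) (a : K) (u v : 'rV[K]_n),
    T [eta x with k |-> a *: u + v] =
    a * T [eta x with k |-> u] + T [eta x with k |-> v].

(* The supremum is taken in the extended reals, so that it needs no
   boundedness side condition. *)
Definition form_norm (p : R) (m n : nat) (T : ('I_m -> 'rV[K]_n) -> K)
    : \bar R :=
  ereal_sup [set (abs (T x))%:E |
              x in [set x : 'I_m -> 'rV[K]_n | forall k, lp_norm p (x k) <= 1]].

(* The multi-index (j_1, ..., j_m) is a finite function j : 'I_m -> 'I_n, and
   [delta_mx 0 i] is the i-th canonical unit vector. *)
Definition hl_sum (p : R) (m n : nat) (T : ('I_m -> 'rV[K]_n) -> K) : R :=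
  (\sum_(j : {ffun 'I_m -> 'I_n})
     abs (T (fun k => delta_mx 0 (j k))) `^ (p / (p - m%:R)))
    `^ ((p - m%:R) / p).

Definition hl_admissible (m : nat) (p D : R) : Prop :=
  1 <= D /\
  forall (n : nat) (T : ('I_m -> 'rV[K]_n) -> K),
    (0 < n)%N -> multilinear_form T ->
    ((hl_sum p T)%:E <= D%:E * form_norm p T)%E.

(* The infimum is taken in the extended reals: if no real constant were
   admissible the value would be +oo, not a junk real number. *)
Definition hl_const (m : nat) (p : R) : \bar R :=
  ereal_inf [set D%:E | D in [set D : R | hl_admissible m p D]].

Lemma hl_const_le (m : nat) (p D : R) :
  hl_admissible m p D -> (hl_const m p <= D%:E)%E.
Proof. by move=> aD; apply: ereal_inf_lbound; exists D. Qed.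

(* Once some constant is admissible, the infimum is attained, so that
   [hl_const] is the smallest admissible constant. *)
Lemma hl_const_admissible (m : nat) (p D0 : R) : hl_admissible m p D0 ->
  exists2 D : R, hl_const m p = D%:E & hl_admissible m p D.
Proof.
move=> aD0.
have h1 : (1%:E <= hl_const m p)%E.
  by apply: le_ereal_inf_tmp => _ [D [D1 _] <-]; rewrite lee_fin.
have := hl_const_le aD0.
case E : (hl_const m p) h1 => [D| |] // h1 _; exists D => //.
have D1 : 1 <= D by rewrite -lee_fin.
have Dle D' : hl_admissible m p D' -> D <= D'.
  by move=> /hl_const_le; rewrite E lee_fin.
split=> // n T n0 mT.
have H D' : hl_admissible m p D' -> ((hl_sum p T)%:E <= D'%:E * form_norm p T)%E.
  by move=> [_ /(_ n T n0 mT)].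
case: (form_norm p T) H => [r| |] H.
- rewrite -EFinM lee_fin; have [r0|r0] := ltP 0 r; last first.
    have := H _ aD0; rewrite -EFinM lee_fin => /le_trans; apply.
    by rewrite ler_wnM2r// Dle.
  rewrite -ler_pdivrMr// -lee_fin -E; apply: le_ereal_inf_tmp => _ [D' aD' <-].
  by have := H _ aD'; rewrite -EFinM !lee_fin ler_pdivrMr.
- by rewrite gt0_muley ?leey// lte_fin (lt_le_trans ltr01).
- have := H _ aD0; rewrite gt0_muleNy ?lte_fin ?(lt_le_trans ltr01 (proj1 aD0))//.
Qed.

End HardyLittlewood.

(* Main.v *)
(* Write s = p/(p-m) and r = p/(p-m-1), so that s >= 2 and 1/r = 1/s - 1/p.
   Freezing one slot v of an (m+1)-linear form T and applying the m-linear
   inequality bounds the l_s norm of (T(v, e_j))_j by D |T| on the unit ball of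
   l_p.  Testing on v = sum_k +-y_k e_k with well chosen signs, and using that
   the scalar field has cotype s with constant 1, gives
     sum_k y_k^s sum_j |T(e_k, e_j)|^s <= (D |T|)^s
   whenever y >= 0 is in the unit ball of l_p.  The duality between l_{p/s} and
   its conjugate exponent r/s bounds the mixed l_r(l_s) norm of the
   coefficients, which dominates their l_r norm because s <= r. *)
Require Import Defs.
From mathcomp Require Import all_boot all_order all_algebra.
From mathcomp Require Import complex ring lra.
From mathcomp Require Import all_classical all_reals all_analysis.

Set Implicit Arguments.
Unset Strict Implicit.
Unset Printing Implicit Defensive.

Import Order.TTheory GRing.Theory Num.Theory.
Local Open Scope ring_scope.

(** * Power inequalities and duality of finite sequence spaces *)

Section PowerInequalities.
Context (R : realType).

(** Each x_i^q factors as x_i x_i^(q-1), and the second factor is at most the (q-1)-th power of the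
    whole sum. *)
Lemma sum_powR_le (I : finType) (x : I -> R) (q : R) :
  1 <= q -> (forall i, 0 <= x i) -> \sum_i x i `^ q <= (\sum_i x i) `^ q.
Proof.
move=> q1 x0; have q0 : 0 < q by exact: lt_le_trans q1.
rewrite -[leRHS]mulr_powRB1 ?sumr_ge0// mulr_suml; apply: ler_sum => i _.
rewrite -mulr_powRB1// ler_wpM2l// ge0_ler_powR ?subr_ge0 ?nnegrE ?sumr_ge0//.
by rewrite (bigD1 i)//= lerDl sumr_ge0.
Qed.

Lemma powR_superadditive (a b q : R) :
  1 <= q -> 0 <= a -> 0 <= b -> a `^ q + b `^ q <= (a + b) `^ q.
Proof.
move=> q1 a0 b0.
have := sum_powR_le (x := fun i : bool => if i then a else b) q1.
by rewrite !big_bool; apply => -[].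
Qed.

Lemma powR_midpoint (a b q : R) :
  1 <= q -> 0 <= a -> 0 <= b ->
  2 * ((a + b) / 2) `^ q <= a `^ q + b `^ q.
Proof.
move=> q1 a0 b0.
have h0 : 0 <= (2^-1 : R) by lra.
have h1 : (2^-1 : R) <= 1 by lra.
have := convex_powR q1 (Itv01 h0 h1) (x := a) (y := b).
rewrite !inE /= !in_itv /= !andbT => /(_ a0 b0).
rewrite [X in X `^ _ <= _]convRE convRE /= /unstable.onem.
rewrite (_ : 1 - 2^-1 = 2^-1 :> R); last by lra.
rewrite -!mulrDr (mulrC 2^-1 (a + b)) => h.
by rewrite -ler_pdivlMl.
Qed.

(** This is the converse of Hölder's inequality for the exponents 1/u and 1/(1-u), with [y]
    recording the 1/u-th powers of the test sequence. The extremal choice is y_k = b_k^t / S. *)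
Lemma lp_duality (n : nat) (b : 'I_n -> R) (u C : R) :
    0 < u < 1 -> (forall k, 0 <= b k) ->
    (forall y : 'I_n -> R, (forall k, 0 <= y k) -> \sum_k y k <= 1 ->
       \sum_k y k `^ u * b k <= C) ->
  (\sum_k b k `^ (1 - u)^-1) `^ (1 - u) <= C.
Proof.
move=> /andP[u0 u1] b0 H; set t := (1 - u)^-1; set S := \sum_k _.
have v0 : 0 < 1 - u by rewrite subr_gt0.
have t0 : 0 < t by rewrite invr_gt0.
have S0 : 0 <= S by apply: sumr_ge0 => *; exact: powR_ge0.
(* The extremal choice divides by [S]; when [S = 0], testing on the zero sequence gives [0 <= C]. *)
have [->|SN0] := eqVneq S 0.
  rewrite powR0 ?gt_eqF//; have := H (fun=> 0) (fun=> lexx 0).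
  rewrite !big1//; first by apply.
  by move=> k _; rewrite powR0 ?mul0r ?gt_eqF.
have Sp : 0 < S by rewrite lt0r SN0.
have := H (fun k => b k `^ t / S) (fun k => divr_ge0 (powR_ge0 _ _) S0).
rewrite -mulr_suml divff// => /(_ (lexx 1)); apply: le_trans.
rewrite powRB ?SN0 ?implybT// powRr1// {1}/S mulr_suml.
apply: ler_sum => k _.
rewrite powRM ?powR_ge0 ?invr_ge0// -powRrM.
rewrite -(powR_inv1 S0) -powRrM mulN1r powRN.
rewrite mulrAC ler_wpM2r ?invr_ge0 ?powR_ge0// mulrC.
rewrite (_ : t * u = t - 1); first by rewrite mulr_powRB1.
by rewrite /t; field; rewrite gt_eqF.
Qed.

End PowerInequalities.

(** * Splitting off the first slot of a family *)

Definition slot_cons {A : Type} {m : nat} (v : A) (x : 'I_m -> A)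
    (i : 'I_m.+1) : A :=
  oapp x v (unlift ord0 i).

Lemma slot_cons0 {A : Type} {m : nat} (v : A) (x : 'I_m -> A) :
  slot_cons v x ord0 = v.
Proof. by rewrite /slot_cons unlift_none. Qed.

Lemma slot_consS {A : Type} {m : nat} (v : A) (x : 'I_m -> A) i :
  slot_cons v x (lift ord0 i) = x i.
Proof. by rewrite /slot_cons liftK. Qed.

Lemma slot_cons_update0 {A : Type} {m : nat} (v w : A) (x : 'I_m -> A) :
  [eta slot_cons v x with ord0 |-> w] = slot_cons w x :> (_ -> _).
Proof.
apply/funext => i /=; case: (unliftP ord0 i) => [j ->|->].
  by rewrite !slot_consS eq_sym (negPf (neq_lift _ _)).
by rewrite eqxx slot_cons0.
Qed.

Lemma slot_cons_updateS {A : Type} {m : nat} (v w : A) (x : 'I_m -> A) k :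
  [eta slot_cons v x with lift ord0 k |-> w] = slot_cons v [eta x with k |-> w]
    :> (_ -> _).
Proof.
apply/funext => i /=; case: (unliftP ord0 i) => [j ->|->].
  by rewrite !slot_consS (inj_eq (@lift_inj _ ord0)).
by rewrite !slot_cons0 (negPf (neq_lift _ _)).
Qed.

(** [F] takes plain functions, so that [slot_cons k j] can be fed to it without being repackaged as
    a finite function. *)
Lemma sum_slot {V : nmodType} {m n : nat} (F : ('I_m.+1 -> 'I_n) -> V) :
  \sum_(j : {ffun 'I_m.+1 -> 'I_n}) F j =
  \sum_(k : 'I_n) \sum_(j : {ffun 'I_m -> 'I_n}) F (slot_cons k j).
Proof.
rewrite pair_bigA /=.
rewrite (reindex (fun kj : 'I_n * {ffun 'I_m -> 'I_n} =>
  [ffun i => slot_cons kj.1 kj.2 i] : {ffun 'I_m.+1 -> 'I_n})) /=.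
  by apply: eq_bigr => kj _; congr F; apply/funext => i; rewrite ffunE.
exists (fun f => (f ord0, [ffun i => f (lift ord0 i)])) => [[k j] _|f _] /=.
  congr pair; first by rewrite ffunE slot_cons0.
  by apply/ffunP => i; rewrite !ffunE slot_consS.
apply/ffunP => i; rewrite ffunE; case: (unliftP ord0 i) => [j ->|->].
  by rewrite slot_consS ffunE.
by rewrite slot_cons0.
Qed.

(** * Scalar fields whose modulus satisfies the parallelogram law *)

Section ScalarField.
Context (R : realType) (K : fieldType) (abs : K -> R) (iota : R -> K)
  (abs_ge0 : forall x, 0 <= abs x)
  (absM : {morph abs : x y / x * y})
  (abs_iota : forall r, abs (iota r) = `|r|)
  (abs_parallelogram : forall x y,
    abs (x + y) ^+ 2 + abs (x - y) ^+ 2 = 2 * (abs x ^+ 2 + abs y ^+ 2)).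

Lemma abs0 : abs 0 = 0.
Proof.
have := abs_parallelogram 0 0; rewrite subrr addr0 => h.
by apply/eqP; rewrite -sqrf_eq0; apply/eqP; lra.
Qed.

Lemma absN x : abs (- x) = abs x.
Proof.
have := abs_parallelogram 0 x; rewrite sub0r add0r abs0 => h.
by apply/eqP; rewrite -(@eqrXn2 _ 2)//; apply/eqP; lra.
Qed.

Lemma abs_sign (b : bool) x : abs ((-1) ^+ b * x) = abs x.
Proof. by case: b; rewrite ?mulN1r ?mul1r ?absN. Qed.

(** The parallelogram law is the case s = 2. For larger s, apply midpoint convexity of the power s/2
    to the squared moduli on the right, then superadditivity of that power. *)
Lemma abs_clarkson (s : R) x y : 2 <= s ->
  2 * (abs x `^ s + abs y `^ s) <= abs (x + y) `^ s + abs (x - y) `^ s.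
Proof.
move=> s2; have q1 : 1 <= s / 2 by lra.
have sqrE z : abs z `^ s = (abs z ^+ 2) `^ (s / 2).
  by rewrite -powR_mulrn// -powRrM; congr (_ `^ _); field.
rewrite !sqrE; apply: le_trans (powR_midpoint q1 (sqr_ge0 _) (sqr_ge0 _)).
rewrite abs_parallelogram mulrAC divff// mul1r ler_pM2l//.
by apply: powR_superadditive => //; exact: sqr_ge0.
Qed.

(* The signs are chosen greedily: by Clarkson's inequality one of u + v and
   u - v is at least as long as the inequality requires. *)
Lemma exists_signs (s : R) (J : finType) (I : eqType) (r : seq I)
    (c : J -> I -> K) : 2 <= s -> uniq r ->
  exists e : I -> bool,
    \sum_(k <- r) \sum_j abs (c j k) `^ s <=
    \sum_j abs (\sum_(k <- r) (-1) ^+ e k * c j k) `^ s.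
Proof.
move=> s2; elim: r => [|k r IH] /=.
  by exists (fun=> false); rewrite big_nil sumr_ge0// => *; exact: powR_ge0.
move=> /andP[kr /IH[e He]].
pose u j := \sum_(l <- r) (-1) ^+ e l * c j l.
pose ext (b : bool) l := if l == k then b else e l.
(* Since [k] does not occur in [r], choosing the sign at [k] leaves the partial sum [u j]
   unchanged. *)
have extE b j : \sum_(l <- k :: r) (-1) ^+ ext b l * c j l =
                u j + (-1) ^+ b * c j k.
  rewrite big_cons {1}/ext eqxx addrC; congr (_ + _).
  rewrite [RHS]big_seq [LHS]big_seq; apply: eq_bigr => l lr.
  by rewrite /ext; case: eqVneq lr kr => // -> ->.
suff [b Hb] : exists b : bool, \sum_j abs (u j) `^ s + \sum_j abs (c j k) `^ s
    <= \sum_j abs (u j + (-1) ^+ b * c j k) `^ s.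
  exists (ext b); rewrite big_cons addrC.
  under [leRHS]eq_bigr do rewrite extE.
  by apply: le_trans Hb; rewrite lerD2r.
(* Clarkson is summed over [j] before the sign is chosen, so that a single sign serves all [j] at
   once. *)
have : 2 * (\sum_j abs (u j) `^ s + \sum_j abs (c j k) `^ s) <=
    \sum_j abs (u j + c j k) `^ s + \sum_j abs (u j - c j k) `^ s.
  by rewrite -!big_split mulr_sumr; apply: ler_sum => j _; exact: abs_clarkson.
set A := (X in 2 * X <= _); set B := (X in _ <= X + _); set C := (X in _ <= _ + X).
move=> h; have [AB|BA] := leP A B.
  exists false; apply: le_trans AB _; rewrite le_eqVlt; apply/orP; left.
  by apply/eqP/eq_bigr => j _; rewrite mul1r.
exists true; have AC : A <= C by lra.
apply: le_trans AC _; rewrite le_eqVlt; apply/orP; left.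
by apply/eqP/eq_bigr => j _; rewrite mulN1r.
Qed.

(** * Multilinear forms with the first slot frozen *)

Section FirstSlot.
Context (m n : nat) (T : ('I_m.+1 -> 'rV[K]_n) -> K)
  (mT : multilinear_form T).

Lemma multilinear_form_slot v : multilinear_form (fun x => T (slot_cons v x)).
Proof. by move=> x k a u w; rewrite -!slot_cons_updateS mT. Qed.

Lemma multilinear_form_sum (c : 'I_n -> K) (w : 'I_n -> 'rV[K]_n) x :
  T (slot_cons (\sum_k c k *: w k) x) = \sum_k c k * T (slot_cons (w k) x).
Proof.
have L a u v : T (slot_cons (a *: u + v) x) =
    a * T (slot_cons u x) + T (slot_cons v x).
  by have := mT (slot_cons 0 x) ord0 a u v; rewrite !slot_cons_update0.
elim/big_rec2 : _ => [|k y1 y2 _ <-]; last exact: L.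
(* The empty sum: T(0) = -T(0) + T(0) = 0 in the first slot. *)
by have := L (-1) 0 0; rewrite scaler0 addr0 mulN1r addNr.
Qed.

Lemma form_norm_slot (p : R) v : lp_norm abs p v <= 1 ->
  (form_norm abs p (fun x => T (slot_cons v x)) <= form_norm abs p T)%E.
Proof.
move=> v1; apply: le_ereal_sup => _ [x x1 <-].
exists (slot_cons v x); last by [].
move=> i; case: (unliftP ord0 i) => [j ->|->].
  by rewrite slot_consS; exact: x1.
by rewrite slot_cons0.
Qed.

End FirstSlot.

(** * The inequality with one more slot *)

Lemma form_norm_ge0 (p : R) (m n : nat) (T : ('I_m -> 'rV[K]_n) -> K) :
  0 < p -> (0 <= form_norm abs p T)%E.
Proof.
move=> p0; apply: (@le_trans _ _ (abs (T (fun=> 0)))%:E).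
  by rewrite lee_fin.
apply: ereal_sup_ubound; exists (fun=> 0) => //= _.
rewrite /lp_norm big1 ?powR0 ?invr_eq0 ?gt_eqF// => i _.
by rewrite mxE abs0 powR0 ?gt_eqF.
Qed.

(* The variable y stands for the p-th powers of the coordinates of the test
   vector, as suits lp_duality. *)
Lemma hl_slot_le (m n : nat) (p M : R) (T : ('I_m.+1 -> 'rV[K]_n) -> K) :
    (0 < m)%N -> m%:R < p -> p <= (2 * m)%:R -> multilinear_form T ->
    (forall v, lp_norm abs p v <= 1 ->
       hl_sum abs p (fun x => T (slot_cons v x)) <= M) ->
  forall y : 'I_n -> R, (forall k, 0 <= y k) -> \sum_k y k <= 1 ->
    \sum_k y k `^ (p - m%:R)^-1 *
      \sum_(j : {ffun 'I_m -> 'I_n})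
        abs (T (slot_cons (delta_mx 0 k) (fun i => delta_mx 0 (j i))))
          `^ (p / (p - m%:R))
    <= M `^ (p / (p - m%:R)).
Proof.
move=> m0 mp p2m mT H y y0 y1; set s := p / (p - m%:R).
have m0' : 0 < m%:R :> R by rewrite ltr0n.
have p0 : 0 < p by lra.
have pm0 : 0 < p - m%:R by lra.
(* The bound p <= 2m says exactly that s >= 2, as the choice of signs requires. *)
have s2 : 2 <= s by rewrite ler_pdivlMr//; rewrite natrM in p2m; lra.
pose a k (j : {ffun 'I_m -> 'I_n}) :=
  T (slot_cons (delta_mx 0 k) (fun i => delta_mx 0 (j i))).
pose x k := iota (y k `^ p^-1).
have xE k : abs (x k) = y k `^ p^-1 by rewrite abs_iota ger0_norm ?powR_ge0.
have [e He] := exists_signs (fun j k => x k * a k j) s2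
  (index_enum_uniq 'I_n).
(* Whatever the signs, the coordinates of [v] have p-th powers [y k], so [v] lies in the unit
   ball. *)
pose v : 'rV[K]_n := \sum_k ((-1) ^+ e k * x k) *: delta_mx 0 k.
have vE k : v 0 k = (-1) ^+ e k * x k.
  rewrite summxE (bigD1 k)//= !mxE !eqxx mulr1 big1 ?addr0// => l lk.
  by rewrite !mxE eq_sym (negPf lk) andbF mulr0.
have v1 : lp_norm abs p v <= 1.
  rewrite /lp_norm (eq_bigr y) => [|k _].
    have one_powR : 1 `^ p^-1 = 1 :> R by rewrite powR1.
    by rewrite -one_powR ge0_ler_powR ?nnegrE ?sumr_ge0 ?invr_ge0// ltW.
  by rewrite vE abs_sign xE -powRrM mulVf ?powRr1// gt_eqF.
have := H v v1; rewrite /hl_sum -/s => Hv.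
have S0 : 0 <= \sum_(j : {ffun 'I_m -> 'I_n})
    abs (T (slot_cons v (fun k => delta_mx 0 (j k)))) `^ s.
  by apply: sumr_ge0 => *; exact: powR_ge0.
have {}Hv : \sum_(j : {ffun 'I_m -> 'I_n})
    abs (T (slot_cons v (fun k => delta_mx 0 (j k)))) `^ s <= M `^ s.
  have s0 : 0 <= s by lra.
  have M0 := le_trans (powR_ge0 _ _) Hv.
  move: Hv => /(ge0_ler_powR s0); rewrite !nnegrE => /(_ (powR_ge0 _ _) M0).
  rewrite -powRrM -[(p - m%:R) / p]invf_div -/s mulVf ?gt_eqF ?powRr1//.
  by lra.
apply: le_trans Hv; under [leRHS]eq_bigr do rewrite (multilinear_form_sum mT).
apply: le_trans (le_trans He _).
  apply: ler_sum => k _; rewrite mulr_sumr; apply: ler_sum => j _.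
  (* The exponents agree because s/p = 1/(p-m). *)
  rewrite absM powRM// xE -powRrM; rewrite le_eqVlt; apply/orP; left.
  by apply/eqP; congr (_ `^ _ * _); rewrite /s; field; rewrite !gt_eqF.
by apply: ler_sum => j _; under eq_bigr do rewrite mulrA.
Qed.

Lemma hl_admissible_succ (m : nat) (p D : R) :
    (0 < m)%N -> m.+1%:R < p -> p <= (2 * m)%:R ->
  hl_admissible abs m p D -> hl_admissible abs m.+1 p D.
Proof.
move=> m0 mp p2m [D1 HD]; split=> // n T n0 mT.
have m0' : 0 < m%:R :> R by rewrite ltr0n.
have mp1 : m%:R + 1 < p by rewrite natr1.
have mp' : m%:R < p by apply: lt_trans mp; rewrite ltr_nat.
have p0 : 0 < p by lra.
have pm0 : 0 < p - m%:R by lra.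
have pm10 : 0 < p - m.+1%:R by lra.
have D0 : 0 < D by lra.
have := form_norm_ge0 T p0.
(* Nonnegativity excludes -oo, and for +oo the right-hand side is +oo because D > 0. *)
case E : (form_norm abs p T) => [N| |]// N0; last first.
  by rewrite gt0_muley ?leey// lte_fin.
rewrite -EFinM lee_fin; rewrite lee_fin in N0.
have Hslot v : lp_norm abs p v <= 1 ->
    hl_sum abs p (fun x => T (slot_cons v x)) <= D * N.
  move=> v1; rewrite -lee_fin EFinM -E.
  apply: le_trans (HD n _ n0 (multilinear_form_slot mT v)) _.
  by apply: lee_wpmul2l; [rewrite lee_fin ltW | exact: form_norm_slot].
set s := p / (p - m%:R); set r := p / (p - m.+1%:R).
pose b k := \sum_(j : {ffun 'I_m -> 'I_n})
  abs (T (slot_cons (delta_mx 0 k) (fun i => delta_mx 0 (j i)))) `^ s.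
have b0 k : 0 <= b k by apply: sumr_ge0 => *; exact: powR_ge0.
(* This is s/p, the exponent of [y k] in [hl_slot_le]; it is below 1 because p > m+1. *)
pose u := (p - m%:R)^-1.
have u01 : 0 < u < 1 by rewrite invr_gt0 pm0 invf_lt1//; lra.
have s0 : 0 < s by rewrite divr_gt0.
have st : s * (1 - u)^-1 = r.
  rewrite /s /u /r -natr1; field.
  by rewrite !gt_eqF//; lra.
have t1 : 1 <= (1 - u)^-1.
  by case/andP: u01 => u0 u1; rewrite invf_ge1 ?subr_gt0//; lra.
have Hb := lp_duality u01 b0 (hl_slot_le m0 mp' p2m mT Hslot).
have r0 : 0 < r by rewrite divr_gt0.
(* Duality bounds the s-th power of the mixed norm; taking s-th roots turns the outer exponent 1-u
   into (1-u)/s = 1/r. *)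
have {}Hb : (\sum_k b k `^ (1 - u)^-1) `^ r^-1 <= D * N.
  have DN0 : 0 <= D * N by apply: mulr_ge0 => //; exact: ltW.
  have si0 : 0 <= s^-1 by rewrite invr_ge0 ltW.
  have := ge0_ler_powR si0 _ _ Hb; rewrite !nnegrE !powR_ge0 => /(_ isT isT).
  rewrite -!powRrM -/s mulfV ?gt_eqF// powRr1//; apply: le_trans.
  by rewrite -st (invfM s) invrK mulrC.
apply: le_trans Hb; rewrite /hl_sum -/r -[in X in X <= _](invf_div p).
rewrite ge0_ler_powR ?nnegrE ?invr_ge0 ?(ltW r0)//.
- by apply: sumr_ge0 => *; exact: powR_ge0.
- by apply: sumr_ge0 => *; exact: powR_ge0.
rewrite (sum_slot (fun j => abs (T (fun k => delta_mx 0 (j k))) `^ r)).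
(* For each first index, the r-th powers are the [(1 - u)^-1]-th powers of the s-th powers, so
   [sum_powR_le] gives the passage from l_r to l_s. *)
apply: ler_sum => k _; apply: le_trans (sum_powR_le t1 _); last first.
  by move=> j; exact: powR_ge0.
apply: ler_sum => j _; rewrite -powRrM st le_eqVlt; apply/orP; left; apply/eqP.
congr (abs (T _) `^ _); apply/funext => i.
case: (unliftP ord0 i) => [l ->|->]; first by rewrite !slot_consS.
by rewrite !slot_cons0.
Qed.

(** Every constant admissible for [m] is admissible for [m.+1], so the latter infimum runs over a
    larger set. *)
Lemma hl_const_succ (m : nat) (p : R) :
    (0 < m)%N -> m.+1%:R < p -> p <= (2 * m)%:R ->
  (hl_const abs m.+1 p <= hl_const abs m p)%E.
Proof.
move=> m0 mp p2m; apply: le_ereal_inf_tmp => _ [D aD <-].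
by apply: hl_const_le; exact: hl_admissible_succ.
Qed.

End ScalarField.

(** * The real and complex moduli *)

Lemma cmod_parallelogram (R : realType) (x y : R[i]) :
  cmod (x + y) ^+ 2 + cmod (x - y) ^+ 2 = 2 * (cmod x ^+ 2 + cmod y ^+ 2).
Proof.
case: x y => [a b] [c d]; rewrite /cmod !normc_def /= !sqr_sqrtr ?addr_ge0 ?sqr_ge0//.
by ring.
Qed.

Lemma cmodM (R : realType) : {morph @cmod R : x y / x * y}.
Proof. by move=> x y; rewrite /cmod normrM !normc_def /= !mul0r subr0. Qed.

Theorem theorem2 (R : realType) (m : nat) (p : R)
    (hm : (2 <= m)%N) (hp1 : m.+1%:R < p) (hp2 : p <= (2 * m)%:R) :
  (hl_const (fun x : R => `|x|%R) m.+1 p <= hl_const (fun x : R => `|x|%R) m p)%E /\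
  (hl_const (@cmod R) m.+1 p <= hl_const (@cmod R) m p)%E.
Proof.
have m0 : (0 < m)%N by exact: ltnW.
split.
- apply: (hl_const_succ (iota := id)) => //; first exact: normrM.
  by move=> x y; rewrite !real_normK ?num_real//; ring.
- apply: (hl_const_succ (iota := real_complex R)) => //.
  + by move=> x; rewrite /cmod normc_def /= sqrtr_ge0.
  + exact: cmodM.
  + by move=> r; rewrite /cmod normc_def /= expr0n addr0 sqrtr_sqr.
  + exact: cmod_parallelogram.
Qed.
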